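(* Let $R$ be a commutative noetherian local ring, and let $\mathcal{X}$ be a resolving subcategory of $\mathrm{mod}\,R$. Then for every nonfree $R$-module $X\in\mathcal{X}$, there exists a nonfree $R$-module $X'\in\mathcal{X}$ satisfying the following two conditions: (1) $\mathrm{step}(X,X')\le 2\dim\mathrm{NF}(X)$, and (2) $X'$ is free on the punctured spectrum of $R$.
   Context: All $R$-modules are assumed finitely generated; $\mathrm{mod}\,R$ is the category of finitely generated $R$-modules. A subcategory of $\mathrm{mod}\,R$ means a full subcategory closed under isomorphisms. A subcategory $\mathcal{X}$ of $\mathrm{mod}\,R$ is resolving if it contains all projective $R$-modules, is closed under direct summands, is closed under extensions (if $0\to L\to M\to N\to 0$ is exact and $L,N\in\mathcal{X}$, then $M\in\mathcal{X}$), and is closed under kernels of epimorphisms (if $0\to L\to M\to N\to 0$ is exact and $M,N\in\mathcal{X}$, then $L\in\mathcal{X}$). The additive closure $\mathrm{add}\,\mathcal{Y}$ of a subcategory $\mathcal{Y}$ consists of all direct summands of finite direct sums of modules in $\mathcal{Y}$. For an $R$-module $X$, define inductively: $\mathrm{res}^0X=\mathrm{add}\{X,R\}$; for $n\ge 1$, $\mathrm{res}^nX$ is the additive closure of the subcategory of all $R$-modules $Y$ admitting an exact sequence of the form $0\to A\to Y\to B\to 0$ or of the form $0\to Y\to A\to B\to 0$ with $A,B\in\mathrm{res}^{n-1}X$. For $R$-modules $X,Y$ put $\mathrm{step}(X,Y)=\inf\{n\ge 0\mid Y\in\mathrm{res}^nX\}$ (equal to $\infty$ if there is no such $n$). The nonfree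 locus $\mathrm{NF}(X)$ of an $R$-module $X$ is the set of prime ideals $\mathfrak{p}$ of $R$ such that the $R_{\mathfrak{p}}$-module $X_{\mathfrak{p}}$ is not free. The dimension $\dim Z$ of a subset $Z\subseteq\mathrm{Spec}\,R$ is the supremum of $\dim R/\mathfrak{p}$ over $\mathfrak{p}\in Z$. A module $Y$ over a local ring $(R,\mathfrak{m})$ is free on the punctured spectrum of $R$ if $Y_{\mathfrak{p}}$ is a free $R_{\mathfrak{p}}$-module for every prime ideal $\mathfrak{p}\ne\mathfrak{m}$. *)

(* Defs.v *)
From HB Require Import structures.
From mathcomp Require Import all_boot all_order all_algebra.
From mathcomp Require Import boolp classical_sets constructive_ereal ring.

Set Implicit Arguments.
Unset Strict Implicit.
Unset Printing Implicit Defensive.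

Import Order.TTheory GRing.Theory Num.Theory.

Local Open Scope ring_scope.
Local Open Scope quotient_scope.

Section Localization.
Variables (R : comNzRingType) (p : prime_idealr R).

Definition loc_den := {s : R | s \notin p}.

Lemma den1_subproof : (1 : R) \notin p.
Proof. by rewrite idealr1. Qed.

Lemma denM_subproof (s t : loc_den) : sval s * sval t \notin p.
Proof. by rewrite prime_idealrM negb_or (valP s) (valP t). Qed.

Definition den1 : loc_den := @exist R (fun s => s \notin p) 1 den1_subproof.
Definition denM (s t : loc_den) : loc_den :=
  @exist R (fun s => s \notin p) (sval s * sval t) (denM_subproof s t).

Section Carrier.
Variable M : lmodType R.
Implicit Types (x y : M) (s t u : loc_den) (z w : M * loc_den).

Definition loc_equiv z w : bool :=
  `[< exists u : loc_den,
        (sval u * sval w.2) *: z.1 = (sval u * sval z.2) *: w.1 >].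

Lemma loc_equiv_is_equiv : equiv_class_of loc_equiv.
Proof.
split=> [[x s]|[x s] [y t]|[y t] [x s] [z w]].
- by apply/asboolP; exists den1.
- by apply/asboolP/asboolP => -[u /= h]; exists u.
- move=> /asboolP[u /= h1] /asboolP[v /= h2]; apply/asboolP.
  exists (denM (denM u v) t) => /=.
  have -> : sval u * sval v * sval t * sval w = (sval v * sval w) * (sval u * sval t).
    by ring.
  rewrite -scalerA h1 scalerA.
  have -> : sval v * sval w * (sval u * sval s) = (sval u * sval s) * (sval v * sval w).
    by ring.
  by rewrite -scalerA h2 scalerA; congr (_ *: _); ring.
Qed.

Canonical loc_equiv_equiv := EquivRelPack loc_equiv_is_equiv.
Canonical loc_equiv_encModRel := defaultEncModRel loc_equiv.

(* The localization of M at p; its elements are the fractions [frac x s]. *)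
Definition loc := {eq_quot loc_equiv}.
HB.instance Definition _ := Choice.on loc.
HB.instance Definition _ := EqQuotient.on loc.

Definition frac x s : loc := \pi_loc (x, s).

Lemma frac_eqP x s y t :
  frac x s = frac y t <->
  exists u : loc_den, (sval u * sval t) *: x = (sval u * sval s) *: y.
Proof.
split=> [/eqP|h]; first by rewrite piE => /asboolP.
by apply/eqP; rewrite piE; apply/asboolP.
Qed.

Definition num (a : loc) : M := (repr a).1.
Definition den (a : loc) : loc_den := (repr a).2.

Lemma frac_numden a : frac (num a) (den a) = a.
Proof. by rewrite /frac /num /den -surjective_pairing reprK. Qed.

Lemma frac_rep x s :
  exists u : loc_den,
    (sval u * sval s) *: num (frac x s) = (sval u * sval (den (frac x s))) *: x.
Proof. by apply/frac_eqP; rewrite frac_numden. Qed.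

Lemma fracW (P : loc -> Prop) : (forall x s, P (frac x s)) -> forall a, P a.
Proof. by move=> h a; rewrite -(frac_numden a). Qed.

Definition loc_zero : loc := frac 0 den1.
Definition loc_opp (a : loc) : loc := frac (- num a) (den a).
Definition loc_add (a b : loc) : loc :=
  frac (sval (den b) *: num a + sval (den a) *: num b) (denM (den a) (den b)).

Lemma frac_opp x s : loc_opp (frac x s) = frac (- x) s.
Proof.
rewrite /loc_opp; have [u h] := frac_rep x s.
by apply/frac_eqP; exists u; rewrite !scalerN h.
Qed.

Lemma frac_add x s y t :
  loc_add (frac x s) (frac y t) = frac (sval t *: x + sval s *: y) (denM s t).
Proof.
rewrite /loc_add; have [u] := frac_rep x s; have [v] := frac_rep y t.
set a := num _; set b := num _; set c := den _; set d := den _ => k h.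
apply/frac_eqP; exists (denM u v) => /=.
rewrite !scalerDr !scalerA; congr (_ + _).
- have -> : sval u * sval v * (sval s * sval t) * sval c
          = (sval v * sval t * sval c) * (sval u * sval s) by ring.
  by rewrite -scalerA h scalerA; congr (_ *: _); ring.
- have -> : sval u * sval v * (sval s * sval t) * sval d
          = (sval u * sval s * sval d) * (sval v * sval t) by ring.
  by rewrite -scalerA k scalerA; congr (_ *: _); ring.
Qed.

Lemma frac_eq1 x s y t : sval t *: x = sval s *: y -> frac x s = frac y t.
Proof. by move=> h; apply/frac_eqP; exists den1; rewrite !mul1r. Qed.

Lemma loc_addA : associative loc_add.
Proof.
elim/fracW=> x s; elim/fracW=> y t; elim/fracW=> z w.
rewrite !frac_add; apply: frac_eq1; rewrite /= !scalerDr !scalerA.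
by rewrite addrA; congr (_ *: _ + _ *: _ + _ *: _); ring.
Qed.

Lemma loc_addC : commutative loc_add.
Proof.
elim/fracW=> x s; elim/fracW=> y t; rewrite !frac_add; apply: frac_eq1.
by rewrite /= addrC mulrC.
Qed.

Lemma loc_add0 : left_id loc_zero loc_add.
Proof.
elim/fracW=> x s; rewrite frac_add; apply: frac_eq1.
by rewrite /= scaler0 add0r scale1r mul1r.
Qed.

Lemma loc_addN : left_inverse loc_zero loc_opp loc_add.
Proof.
elim/fracW=> x s; rewrite frac_opp frac_add; apply: frac_eq1.
by rewrite /= scalerN addNr !scaler0.
Qed.

HB.instance Definition _ :=
  GRing.isZmodule.Build loc loc_addA loc_addC loc_add0 loc_addN.

End Carrier.

(* The local ring of R at p. *)
Definition loc_ring : Type := loc R^o.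
HB.instance Definition _ := GRing.Zmodule.on loc_ring.

Definition loc_scale (M : lmodType R) (a : loc_ring) (b : loc M) : loc M :=
  frac ((num a : R) *: num b) (denM (den a) (den b)).

Lemma frac_scale (M : lmodType R) (r : R^o) s (x : M) t :
  loc_scale (frac r s) (frac x t) = frac ((r : R) *: x) (denM s t).
Proof.
rewrite /loc_scale; have [u] := frac_rep r s; have [v] := frac_rep x t.
set b := num _; set a := num _; set d := den _; set c := den _ => k h.
apply/frac_eqP; exists (denM u v) => /=.
have {}h : sval u * sval s * (a : R) = sval u * sval c * (r : R) := h.
rewrite !scalerA.
have -> : sval u * sval v * (sval s * sval t) * (a : R)
        = (sval u * sval s * a) * (sval v * sval t) by ring.
by rewrite -scalerA k scalerA h; congr (_ *: _); ring.
Qed.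


Definition loc_one : loc_ring := frac (1 : R^o) den1.
Definition loc_mul (a b : loc_ring) : loc_ring := loc_scale a (b : loc R^o).

Lemma frac_mul (x y : R) s t :
  loc_mul (frac (x : R^o) s) (frac (y : R^o) t) = frac ((x * y : R) : R^o) (denM s t).
Proof. exact: frac_scale. Qed.

Lemma frac_addR (x y : R) s t :
  loc_add (frac (x : R^o) s) (frac (y : R^o) t) =
  frac ((sval t * x + sval s * y : R) : R^o) (denM s t).
Proof. exact: frac_add. Qed.

Lemma frac_eq1R (x y : R) s t :
  sval t * x = sval s * y -> frac (x : R^o) s = frac (y : R^o) t.
Proof. by move=> h; apply: (@frac_eq1 R^o). Qed.

Lemma loc_mulA : associative loc_mul.
Proof.
elim/fracW=> x s; elim/fracW=> y t; elim/fracW=> z w.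
by rewrite (frac_mul y z) (frac_mul x) (frac_mul x) (frac_mul _ z); apply: frac_eq1R => /=; ring.
Qed.

Lemma loc_mulC : commutative loc_mul.
Proof.
elim/fracW=> x s; elim/fracW=> y t.
by rewrite (frac_mul x) (frac_mul y); apply: frac_eq1R => /=; ring.
Qed.

Lemma loc_mul1 : left_id loc_one loc_mul.
Proof.
elim/fracW=> x s; rewrite (frac_mul _ x).
by apply: frac_eq1R => /=; ring.
Qed.

Lemma loc_mulDl : left_distributive loc_mul +%R.
Proof.
elim/fracW=> x s; elim/fracW=> y t; elim/fracW=> z w.
rewrite [X in loc_mul X _](frac_addR x y) (frac_mul _ z) (frac_mul x) (frac_mul y)
  [RHS]frac_addR.
by apply: frac_eq1R => /=; ring.
Qed.

Lemma loc_one_neq0 : loc_one != 0.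
Proof.
apply/eqP => /frac_eqP[u]; rewrite scaler0 /GRing.scale /= !mulr1 => u0.
by have := valP u; rewrite /= u0 idealr0.
Qed.

HB.instance Definition _ := GRing.Zmodule_isComNzRing.Build loc_ring
  loc_mulA loc_mulC loc_mul1 loc_mulDl loc_one_neq0.

Section Scale.
Variable M : lmodType R.

Lemma loc_scaleA (a b : loc_ring) (v : loc M) :
  loc_scale a (loc_scale b v) = loc_scale (a * b) v.
Proof.
elim/fracW: a => x s; elim/fracW: b => y t; elim/fracW: v => z w.
rewrite [_ * _](frac_mul x y) (frac_scale y) (frac_scale x) (frac_scale _ _ z).
apply: frac_eq1 => /=.
by rewrite !scalerA; congr (_ *: _); ring.
Qed.

Lemma loc_scale1 : left_id (1 : loc_ring) (@loc_scale M).
Proof.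
elim/fracW=> z w; rewrite (frac_scale (1 : R^o) _ z).
by apply: frac_eq1; rewrite /= scale1r mul1r.
Qed.

Lemma loc_scaleDr : right_distributive (@loc_scale M) +%R.
Proof.
elim/fracW=> x s; elim/fracW=> y t; elim/fracW=> z w.
rewrite [X in loc_scale _ X](frac_add y) !(frac_scale x) [RHS]frac_add.
apply: frac_eq1 => /=.
by rewrite !scalerDr !scalerA; congr (_ *: _ + _ *: _); ring.
Qed.

Lemma loc_scaleDl (v : loc M) : {morph (@loc_scale M)^~ v : a b / a + b}.
Proof.
elim/fracW=> x s; elim/fracW=> y t; elim/fracW: v => z w.
rewrite [X in loc_scale X](frac_addR x y) (frac_scale x) (frac_scale y)
  (frac_scale _ _ z) [RHS]frac_add.
apply: frac_eq1 => /=.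
by rewrite !scalerDr !scalerA -scalerDl; congr (_ *: _); ring.
Qed.

HB.instance Definition _ := GRing.Zmodule_isLmodule.Build loc_ring (loc M)
  loc_scaleA loc_scale1 loc_scaleDr loc_scaleDl.

End Scale.

End Localization.

Section Modules.
Variable R : comNzRingType.
Implicit Types (L M N A B P X Y : lmodType R).

Definition isomorphic M N : Prop := exists f : {linear M -> N}, bijective f.

Definition spanned M (s : seq M) (x : M) : Prop :=
  exists c : 'I_(size s) -> R, x = \sum_i c i *: s`_i.

Definition fin_gen M : Prop := exists s : seq M, forall x, spanned s x.

(* Free of finite rank, which is what freeness means for a finitely generated
   module over a nonzero ring. *)
Definition free_module M : Prop := exists n, isomorphic M 'rV[R]_n.

Definition projective P : Prop :=
  forall M N (g : {linear M -> N}) (h : {linear P -> N}),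
    (forall y, exists x, g x = y) ->
    exists f : {linear P -> M}, forall x, g (f x) = h x.

Definition short_exact L M N (f : {linear L -> M}) (g : {linear M -> N}) : Prop :=
  [/\ injective f,
      (forall y, g y = 0 <-> exists x, f x = y)
    & (forall z, exists y, g y = z)].

Definition has_ses L M N : Prop :=
  exists (f : {linear L -> M}) (g : {linear M -> N}), short_exact f g.

Definition direct_summand M N : Prop :=
  exists M' : lmodType R, isomorphic (M * M')%type N.

Definition subcategory (C : lmodType R -> Prop) : Prop :=
  (forall M, C M -> fin_gen M) /\ (forall M N, isomorphic M N -> C M -> C N).

Definition resolving (C : lmodType R -> Prop) : Prop :=
  subcategory C /\
  [/\ (forall P, fin_gen P -> projective P -> C P),
      (forall M N, direct_summand M N -> C N -> C M),
      (forall L M N, has_ses L M N -> C L -> C N -> C M)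
    & (forall L M N, has_ses L M N -> C M -> C N -> C L)].

Inductive fin_dsum (C : lmodType R -> Prop) : lmodType R -> Prop :=
| fin_dsum0 : fin_dsum C 'rV[R]_0
| fin_dsumS M N : C M -> fin_dsum C N -> fin_dsum C (M * N)%type.

Definition add_closure (C : lmodType R -> Prop) (M : lmodType R) : Prop :=
  exists2 N, fin_dsum C N & direct_summand M N.

Fixpoint res (n : nat) X : lmodType R -> Prop :=
  match n with
  | 0 => add_closure (fun Y => isomorphic Y X \/ isomorphic Y R^o)
  | n'.+1 => add_closure (fun Y => fin_gen Y /\
      exists A B, [/\ res n' X A, res n' X B & has_ses A Y B \/ has_ses Y A B])
  end.

Definition step X Y : \bar int :=
  infimum +oo%E [set (n%:Z)%:E | n in [set n | res n X Y]].

Definition noetherian : Prop :=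
  forall I : submodClosed R^o,
    exists s : seq R^o, forall x, x \in I <-> spanned s x.

(* [idealr R] is the type of proper ideals. *)
Definition maximal_ideal (m : idealr R) : Prop :=
  forall J : idealr R, {subset m <= J} -> {subset J <= m}.

Definition local_ring (m : idealr R) : Prop :=
  maximal_ideal m /\ forall J : idealr R, maximal_ideal J -> J =i m.

Definition prime_chain (n : nat) (q : nat -> prime_idealr R) : Prop :=
  forall i, (i < n)%N ->
    {subset q i <= q i.+1} /\ ~ {subset q i.+1 <= q i}.

Definition krull_dim : \bar int :=
  supremum -oo%E [set (n%:Z)%:E | n in [set n | exists q, prime_chain n q]].

End Modules.

(* A plain predicate: universe constraints forbid [set (prime_idealr R)]. *)
Definition NF (R : comNzRingType) (X : lmodType R) : prime_idealr R -> Prop :=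
  fun p => ~ free_module (loc p X).

Definition dim_locus (R : comNzRingType) (Z : prime_idealr R -> Prop) : \bar int :=
  supremum -oo%E [set d | exists2 p, Z p & d = krull_dim {ideal_quot p}].

Definition free_on_punctured_spectrum (R : comNzRingType) (m : idealr R)
    (Y : lmodType R) : Prop :=
  forall p : prime_idealr R, ~ (p =i m) -> free_module (loc p Y).

(* Main.v *)
(* Let F -> X be a minimal free cover with kernel K and let x be in m.  Multiplying the
   class of 0 -> K -> F -> X -> 0 by x gives an extension 0 -> K -> N -> X -> 0, realised
   here as the pullback N = {(f, y) in F * X | pi f = x y}.  As K is one step away from X,
   N is two steps away.
   - N_p is free if x is invertible at p (then N_p = F_p) or if X_p is free (then the
     extension splits at p and N_p = K_p + X_p = F_p); so NF(N) lies in V(x) and in NF(X).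
   - N is not free: otherwise N -> X factors through F, and this yields K = m K, so that
     K = 0 by Nakayama and X = F.
   NF(X) is closed, so finitely many primes of NF(X) lie below all its elements, and prime
   avoidance gives an x in m outside those different from m; passing from X to N then lowers
   the dimension of the nonfree locus.  If that dimension is infinite, the bound on steps is
   void and Noetherian induction on an ideal I with NF(X) inside V(I) suffices.
   Freeness at p is handled through [free_upto u X]: there are maps F' -> X -> F', with F'
   free, whose two composites are multiplication by u.  For finitely presented X, the module
   X_p is free iff this holds for some u outside p. *)
Require Import Defs.
From HB Require Import structures.
From mathcomp Require Import all_boot all_order all_algebra.
From mathcomp Require Import boolp classical_sets constructive_ereal.
From mathcomp Require Import ring.
From Stdlib Require List.

Set Implicit Arguments.
Unset Strict Implicit.
Unset Printing Implicit Defensive.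

Import Order.TTheory GRing.Theory Num.Theory.

Local Open Scope ring_scope.

(** * Kernels and linear maps *)

Section Kernel.
Variables (R : comNzRingType) (M N : lmodType R) (f : {linear M -> N}).

Definition ker_pred : {pred M} := fun x => f x == 0.

Lemma ker_pred_closed : submod_closed ker_pred.
Proof.
split=> [|a u v]; rewrite !unfold_in ?linear0 // => /eqP fu /eqP fv.
by rewrite linearP fu fv scaler0 addr0.
Qed.

HB.instance Definition _ :=
  GRing.isSubmodClosed.Build R M ker_pred (GRing.submod_closed_semi ker_pred_closed).

Record kernel := Kernel { ker_val :> M; _ : ker_val \in ker_pred }.

HB.instance Definition _ := [isSub for ker_val].
HB.instance Definition _ := [Choice of kernel by <:].
HB.instance Definition _ := [SubChoice_isSubLmodule of kernel by <:].

End Kernel.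

Section LinearMaps.
Variable R : comNzRingType.
Implicit Types (K L M N X : lmodType R).

(** Serves to build linear maps inside proofs; each is then known only through its values. *)
Lemma linear_pack M N (f : M -> N) :
  (forall a u v, f (a *: u + v) = a *: f u + f v) ->
  exists g : {linear M -> N}, forall x, g x = f x.
Proof.
move=> lf; pose g : {linear M -> N} := HB.pack f (GRing.isLinear.Build R M N *:%R f lf).
by exists g.
Qed.

Lemma kernel_exists M N (f : {linear M -> N}) :
  exists (K : lmodType R) (i : {linear K -> M}),
    injective i /\ forall y, f y = 0 <-> exists x, i x = y.
Proof.
exists (kernel f).
have [i iE] := @linear_pack (kernel f) M val (fun a u v => linearP _ _ _ _).
exists i; split=> [x y|y]; first by rewrite !iE; apply: val_inj.
split=> [fy|[x <-]]; last by rewrite iE; apply/eqP; exact: valP x.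
have kfy : y \in ker_pred f by apply/eqP.
by exists (Kernel kfy); rewrite iE.
Qed.

Lemma factor_inj K L M (i : {linear K -> M}) (f : {linear L -> M}) :
  injective i -> (forall x, exists y, i y = f x) ->
  exists g : {linear L -> K}, forall x, i (g x) = f x.
Proof.
move=> i_inj fi; have [g gE] := choice fi.
have [|h hE] := @linear_pack L K g; last by exists h => x; rewrite hE.
by move=> a u v; apply: i_inj; rewrite linearP !gE linearP.
Qed.

(** A set-theoretic section [s] of [q] is enough: [f] vanishes on the kernel of [q], so [f \o s]
    does not depend on the choice of [s] and is linear. *)
Lemma factor_surj K L M (q : {linear L -> M}) (f : {linear L -> K}) :
  (forall y, exists x, q x = y) -> (forall x, q x = 0 -> f x = 0) ->
  exists g : {linear M -> K}, forall x, g (q x) = f x.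
Proof.
move=> q_surj fq; have [s sE] := choice q_surj.
have fqE x y : q x = q y -> f x = f y.
  move=> qxy; apply/eqP; rewrite -subr_eq0 -linearB; apply/eqP/fq.
  by rewrite linearB qxy subrr.
have [|h hE] := @linear_pack M K (f \o s).
  by move=> a u v /=; rewrite -linearP; apply: fqE; rewrite linearP !sE.
by exists h => x; rewrite hE; apply: fqE; rewrite sE.
Qed.

Lemma linear_of_family n M (y : 'I_n -> M) :
  exists f : {linear 'rV[R]_n -> M}, forall v, f v = \sum_i v 0 i *: y i.
Proof.
apply: linear_pack => a u v; rewrite scaler_sumr -big_split /=.
by apply: eq_bigr => i _; rewrite !mxE scalerDl scalerA.
Qed.

Lemma linear_rVE n M (f : {linear 'rV[R]_n -> M}) v :
  f v = \sum_i v 0 i *: f (delta_mx 0 i).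
Proof. by rewrite {1}(row_sum_delta v) linear_sum; apply: eq_bigr => i _; rewrite linearZ. Qed.

Lemma lift_rV n M N (q : {linear M -> N}) (f : {linear 'rV[R]_n -> N}) :
  (forall y, exists x, q x = y) ->
  exists g : {linear 'rV[R]_n -> M}, forall v, q (g v) = f v.
Proof.
move=> q_surj; have [y yE] := choice (fun i => q_surj (f (delta_mx 0 i))).
have [g gE] := linear_of_family y; exists g => v.
by rewrite gE linear_sum linear_rVE; apply: eq_bigr => i _; rewrite linearZ yE.
Qed.

Lemma fin_gen_surj M :
  fin_gen M <-> exists n (f : {linear 'rV[R]_n -> M}), forall y, exists x, f x = y.
Proof.
split=> [[s sM]|[n [f f_surj]]].
  exists (size s); have [f fE] := linear_of_family (fun i : 'I_(size s) => s`_i).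
  exists f => y; have [c ->] := sM y; exists (\row_i c i).
  by rewrite fE; apply: eq_bigr => i _; rewrite mxE.
pose s := [seq f (delta_mx 0 i) | i <- enum 'I_n].
have es : size s = n by rewrite size_map size_enum_ord.
exists s => y; have [v <-] := f_surj y; exists (fun i => v 0 (cast_ord es i)).
rewrite linear_rVE (reindex (cast_ord es)) /=; last first.
  by apply: onW_bij; exists (cast_ord (esym es)) => i; rewrite ?cast_ordK ?cast_ordKV.
apply: eq_bigr => i _; congr (_ *: _).
have lin : (i < n)%N by rewrite -[X in (_ < X)%N]es.
rewrite (nth_map (cast_ord es i)) ?size_enum_ord //; congr (f (delta_mx 0 _)).
by apply: val_inj; rewrite /= nth_enum_ord.
Qed.

Lemma injective_surjective_bij M N (f : M -> N) :
  injective f -> (forall y, exists x, f x = y) -> bijective f.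
Proof.
move=> f_inj f_surj; have [g gE] := choice f_surj.
by exists g => x //; apply: f_inj; rewrite gE.
Qed.

Lemma iso_sym M N : isomorphic M N -> isomorphic N M.
Proof.
move=> [f f_bij]; have [g fK gK] := f_bij.
have [|h hE] := @linear_pack N M g; last by exists h; exists f => x; rewrite hE.
by move=> a u v; apply: (bij_inj f_bij); rewrite linearP !gK.
Qed.

Lemma iso_refl M : isomorphic M M.
Proof. by exists idfun; exists id. Qed.

Lemma iso_trans L M N : isomorphic L M -> isomorphic M N -> isomorphic L N.
Proof. by move=> [f f_bij] [g g_bij]; exists (g \o f); apply: bij_comp. Qed.

End LinearMaps.

(** * Covers, syzygies and free modules up to a scalar *)

Section Resolution.
Variable R : comNzRingType.
Implicit Types (K L M N X Y : lmodType R).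

Lemma fin_gen_rV n : fin_gen 'rV[R]_n.
Proof. by apply/fin_gen_surj; exists n, idfun => y; exists y. Qed.

Lemma projective_rV n : projective 'rV[R]_n.
Proof. by move=> M N g h; apply: lift_rV. Qed.

Lemma prod_rV0_iso M : isomorphic (M * 'rV[R]_0)%type M.
Proof.
exists fst; apply: injective_surjective_bij => [[x v] [y w] /= ->|y].
  by rewrite (thinmx0 v) (thinmx0 w).
by exists (y, 0).
Qed.

Lemma rVS_iso n : isomorphic 'rV[R]_n.+1 (R^o * 'rV[R]_n)%type.
Proof.
have [|f fE] := @linear_pack R 'rV[R]_n.+1 (R^o * 'rV[R]_n)%type
  (fun v => (v 0 0 : R^o, \row_j v 0 (lift 0 j))).
  by move=> a u v; congr (_, _); [rewrite !mxE|apply/rowP => j; rewrite !mxE].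
exists f; apply: injective_surjective_bij => [v w|[a v]].
  rewrite !fE => -[v0 /rowP vw]; apply/rowP => i.
  by case: (unliftP 0 i) => [j ->|-> //]; have := vw j; rewrite !mxE.
exists (\row_i oapp (v 0) a (unlift 0 i)); rewrite fE; congr (_, _).
  by rewrite mxE unlift_none.
by apply/rowP => j; rewrite !mxE liftK.
Qed.

Lemma prod_iso L M N : isomorphic M N -> isomorphic (L * M)%type (L * N)%type.
Proof.
move=> [f f_bij]; have [|g gE] := @linear_pack R (L * M)%type (L * N)%type
  (fun z => (z.1, f z.2)); first by move=> a u v; congr (_, _); rewrite linearP.
have [f' fK f'K] := f_bij.
by exists g; exists (fun z => (z.1, f' z.2)) => -[y z]; rewrite gE /= ?fK ?f'K.
Qed.

Lemma iso_summand M N : isomorphic M N -> direct_summand M N.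
Proof. by move=> MN; exists 'rV[R]_0; apply: iso_trans (prod_rV0_iso M) MN. Qed.

Lemma add_closure_rV0 (D : lmodType R -> Prop) : add_closure D 'rV[R]_0.
Proof. by exists 'rV[R]_0; [exact: fin_dsum0|exact/iso_summand/iso_refl]. Qed.

Lemma sub_add_closure (D : lmodType R -> Prop) Y : D Y -> add_closure D Y.
Proof.
move=> DY; exists (Y * 'rV[R]_0)%type; first by apply: fin_dsumS => //; apply: fin_dsum0.
by apply/iso_summand/iso_sym/prod_rV0_iso.
Qed.

Lemma fin_dsum_rV (D : lmodType R -> Prop) n : D R^o ->
  exists2 N, fin_dsum D N & isomorphic 'rV[R]_n N.
Proof.
move=> DR; elim: n => [|n [N DN iN]].
  by exists 'rV[R]_0; [exact: fin_dsum0|exact: iso_refl].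
exists (R^o * N)%type; first exact: fin_dsumS.
exact: iso_trans (rVS_iso n) (prod_iso _ iN).
Qed.

Lemma has_ses_id M : has_ses M M 'rV[R]_0.
Proof.
exists idfun, \0; split=> [x y //|y|z]; last by exists 0; rewrite (thinmx0 z).
by split=> // _; exists y.
Qed.

Lemma res_rV0 k X : res k X 'rV[R]_0.
Proof. by case: k => [|k]; apply: add_closure_rV0. Qed.

(** Uses the exact sequence 0 -> Y -> Y -> 0 -> 0. *)
Lemma res_succ k X Y : fin_gen Y -> res k X Y -> res k.+1 X Y.
Proof.
move=> Yfg Yk; apply: sub_add_closure; split=> //.
by exists Y, 'rV[R]_0; split=> //; [exact: res_rV0|left; apply: has_ses_id].
Qed.

Lemma res_rV k X n : res k X 'rV[R]_n.
Proof.
elim: k => [|k IHk]; last exact/res_succ/IHk/fin_gen_rV.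
have [|N NR iN] := @fin_dsum_rV (fun Y => isomorphic Y X \/ isomorphic Y R^o) n.
  by right; apply: iso_refl.
by exists N => //; apply: iso_summand.
Qed.

Lemma res_self X : res 0 X X.
Proof. by apply: sub_add_closure; left; apply: iso_refl. Qed.

Lemma resolving_rV (C : lmodType R -> Prop) n : resolving C -> C 'rV[R]_n.
Proof. by case=> _ [+ _ _ _]; apply; [exact: fin_gen_rV|exact: projective_rV]. Qed.

Lemma resolving_fin_gen (C : lmodType R -> Prop) X : resolving C -> C X -> fin_gen X.
Proof. by case=> -[+ _] _; apply. Qed.

(** Once [u] is inverted, [f] is an isomorphism with inverse [g / u]. *)
Definition iso_upto (u : R) M N : Prop :=
  exists (f : {linear M -> N}) (g : {linear N -> M}),
    (forall x, g (f x) = u *: x) /\ (forall y, f (g y) = u *: y).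

Definition free_upto (u : R) M : Prop := exists n, iso_upto u 'rV[R]_n M.

Lemma free_free_upto1 M : free_upto 1 M -> free_module M.
Proof.
move=> [n [f [g [gf fg]]]]; exists n; exists g; exists f => z.
  by rewrite fg scale1r.
by rewrite gf scale1r.
Qed.

Lemma free_upto_mull u v M : free_upto u M -> free_upto (v * u) M.
Proof.
move=> [n [f [g [gf fg]]]]; exists n, f.
have [|h hE] := @linear_pack R M 'rV[R]_n (fun x => v *: g x).
  by move=> a x y; rewrite linearP scalerDr !scalerA mulrC.
by exists h; split=> z; rewrite hE ?linearZ /= ?gf ?fg scalerA.
Qed.

Variable m : idealr R.

Definition minimal_cover n M (p : {linear 'rV[R]_n -> M}) : Prop :=
  (forall y, exists x, p x = y) /\
  (forall v : 'rV[R]_n, p v = 0 -> forall i, v 0 i \in m).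

(** Take the least possible [n]: a relation whose coordinate [i] is a unit would express generator
    [i] through the others. *)
Lemma minimal_coverP : (forall a, a \notin m -> exists b, b * a = 1) ->
  forall M, fin_gen M -> exists n (p : {linear 'rV[R]_n -> M}), minimal_cover p.
Proof.
move=> m_unit M /fin_gen_surj M_fg.
pose gen n := exists p : {linear 'rV[R]_n -> M}, forall y, exists x, p x = y.
have exgen : exists n, `[< gen n >] by have [n h] := M_fg; exists n; apply/asboolP.
have [n /asboolP[p p_surj] n_min] := ex_minnP exgen; exists n, p; split=> // v pv i.
apply/negPn/negP => /m_unit[b bv].
case: n => [|n] in p p_surj n_min v pv i bv *; first by case: i bv.
suff : (n.+1 <= n)%N by rewrite ltnn.
apply: n_min; apply/asboolP.
have [q qE] := linear_of_family (fun j => p (delta_mx 0 (lift i j))).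
exists q => y; have [u <-] := p_surj y.
pose w := u - (u 0 i * b) *: v.
have -> : p u = p w by rewrite linearB linearZ /= pv scaler0 subr0.
exists (\row_j w 0 (lift i j)).
rewrite qE (linear_rVE p) (bigD1_ord i) //= [w 0 i]mxE !mxE -mulrA bv mulr1 subrr.
by rewrite scale0r add0r; apply: eq_bigr => j _; rewrite !mxE.
Qed.

(** For [n > 0] the first generator is [p v] with the coordinates of [v] in [m], so the first
    coordinate of the relation [delta_mx 0 0 - v] is in [m]; adding [v 0 0] puts 1 in [m]. *)
Lemma nakayama n M (p : {linear 'rV[R]_n -> M}) : minimal_cover p ->
  (forall y : M, exists2 v : 'rV[R]_n, (forall i, v 0 i \in m) & y = p v) ->
  forall y : M, y = 0.
Proof.
move=> [p_surj p_min] mM y.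
case: n => [|n] in p p_surj p_min mM *.
  by have [v <-] := p_surj y; rewrite (thinmx0 v) linear0.
have [v vm pv] := mM (p (delta_mx 0 0)).
have := p_min (delta_mx 0 0 - v); rewrite linearB pv subrr => /(_ erefl 0).
by rewrite !mxE /= => h; have := rpredD h (vm 0); rewrite subrK idealr1.
Qed.

End Resolution.

(** * The extension multiplied by a scalar *)

Section Pullback.
Variables (R : comNzRingType) (X K N : lmodType R) (n : nat).
Variables (p : {linear 'rV[R]_n -> X}) (i : {linear K -> 'rV[R]_n}) (x : R).
Variable e : {linear N -> ('rV[R]_n * X)%type}.
Hypothesis p_surj : forall y, exists v, p v = y.
Hypothesis i_inj : injective i.
Hypothesis i_ker : forall v, p v = 0 <-> exists w, i w = v.
Hypothesis e_inj : injective e.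
Hypothesis e_img : forall z, p z.1 = x *: z.2 <-> exists y, e y = z.

Let e_eq y : p (e y).1 = x *: (e y).2.
Proof. by apply/e_img; exists y. Qed.

Let e_fst : exists g : {linear N -> 'rV[R]_n}, forall z, g z = (e z).1.
Proof. by apply: linear_pack => a u v; rewrite linearP. Qed.

Let e_snd : exists g : {linear N -> X}, forall z, g z = (e z).2.
Proof. by apply: linear_pack => a u v; rewrite linearP. Qed.

Let pi_comp0 w : p (i w) = 0.
Proof. by apply/i_ker; exists w. Qed.

(** The universal property of the pullback; the maps [h], [f] and [j] into [N] below come from
    it. *)
Let to_pullback (L : lmodType R) (f : L -> 'rV[R]_n) (g : L -> X) :
  linear f -> linear g -> (forall z, p (f z) = x *: g z) ->
  exists h : {linear L -> N}, forall z, e (h z) = (f z, g z).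
Proof.
move=> lf lg fg; have [|c cE] := @linear_pack R L ('rV[R]_n * X)%type (fun z => (f z, g z)).
  by move=> a u v; rewrite lf lg.
have [|h hE] := factor_inj (f := c) e_inj; last by exists h => z; rewrite hE cE.
by move=> z; rewrite cE; apply/e_img; rewrite /= fg.
Qed.

(** [K] enters as the pairs [(i w, 0)]; the map to [X] is the second projection, onto because [p]
    is. *)
Lemma pullback_ses : has_ses K N X.
Proof.
have [|||h hE] := to_pullback (f := i) (g := fun _ => 0).
- exact: linearP.
- by move=> a u v; rewrite scaler0 addr0.
- by move=> w; rewrite pi_comp0 scaler0.
have [q qE] := e_snd.
exists h, q; split=> [w w' hw|y|y].
- by apply: i_inj; have := congr1 e hw; rewrite !hE => -[].
- rewrite qE; split=> [y0|[w <-]]; last by rewrite hE.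
  have [w iw] : exists w, i w = (e y).1 by apply/i_ker; rewrite e_eq y0 scaler0.
  by exists w; apply: e_inj; rewrite hE iw [RHS]surjective_pairing y0.
- have [v pv] := p_surj (x *: y).
  have [z ez] : exists z, e z = (v, y) by apply/e_img.
  by exists z; rewrite qE ez.
Qed.

(** Uses [v |-> (x *: v, p v)] and the first projection. *)
Lemma pullback_free_upto : free_upto x N.
Proof.
have [|||f fE] := to_pullback (f := fun v => x *: v) (g := p).
- by move=> a u v; rewrite scalerDr !scalerA mulrC.
- exact: linearP.
- by move=> v; rewrite linearZ.
have [g gE] := e_fst.
exists n, f, g; split=> [v|z]; first by rewrite gE fE.
apply: e_inj; rewrite fE gE linearZ /= e_eq.
by rewrite [e z in RHS]surjective_pairing.
Qed.

(* The extension splits after inverting [u], so that [N] becomes [K + X], that is, ['rV_n]. *)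
Lemma pullback_free_upto_sqr u : free_upto u X -> free_upto (u * u) N.
Proof.
move=> [k [f [g [_ fg]]]]; have [l lE] := lift_rV f p_surj.
pose s y := l (g y).
have ps y : p (s y) = u *: y by rewrite /s lE fg.
have sP a y z : s (a *: y + z) = a *: s y + s z by rewrite /s !linearP.
(* After inverting [u], [s / u] splits [p]. This is [u] times the map that sends [v = w + s y / u],
   with [y = p v] and [w] in [K], to [(w, 0) + (x s y / u, y)]. *)
have [|||h hE] := to_pullback (f := fun v => u *: v - (1 - x) *: s (p v))
                              (g := fun v => u *: p v).
- move=> a v w; rewrite [p _]linearP sP !scalerDr !scalerN opprD !scalerA.
  by rewrite [u * a]mulrC [_ * a]mulrC addrACA.
- by move=> a v w; rewrite [p _]linearP scalerDr !scalerA mulrC.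
- move=> v; rewrite linearB !linearZ /= ps scalerN !scalerA.
  by rewrite -scalerBl; congr (_ *: _); ring.
(* Likewise [u] times the inverse map, which sends [(f, y)] to [f + (1 - x) s y / u]. *)
have [|c cE] := @linear_pack R N 'rV[R]_n (fun z => u *: (e z).1 + (1 - x) *: s (e z).2).
  move=> a y z; rewrite [e _]linearP sP !scalerDr !scalerA.
  by rewrite [u * a]mulrC [_ * a]mulrC addrACA.
have sZ a y : s (a *: y) = a *: s y by rewrite /s !linearZ.
exists n, h, c; split=> [v|z].
  rewrite cE hE /= sZ scalerBr !scalerA.
  by rewrite [(1 - x) * u]mulrC subrK.
apply: e_inj; rewrite hE cE.
have -> : p (u *: (e z).1 + (1 - x) *: s (e z).2) = u *: (e z).2.
  rewrite linearD !linearZ /= ps e_eq !scalerA -scalerDl.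
  by congr (_ *: _); ring.
rewrite sZ scalerDr !scalerA [(1 - x) * u]mulrC addrK linearZ /=.
by rewrite [e z in RHS]surjective_pairing.
Qed.

Variable m : idealr R.
Hypothesis p_min : minimal_cover m p.
Hypothesis m_unit : forall a, a \notin m -> exists b, b * a = 1.

(* If [N] is free, [N -> X] lifts to some [l : N -> 'rV_n]. Composing with the canonical
   [j : 'rV_n -> N], put [rho = l j - 1 : 'rV_n -> K]; on [K] this gives
   [w = x *: l w - rho w], hence [K = m K] because [K] lies in [m 'rV_n]. *)
Lemma pullback_not_free : x \in m -> fin_gen K -> ~ free_module X -> ~ free_module N.
Proof.
move=> xm Kfg Xnf [d /iso_sym[a [b aK bK]]]; apply: Xnf.
have [q qE] := e_snd.
have [l lE] := @lift_rV R d _ _ p (q \o a) p_surj.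
(* The inverse [b] is a bare function, linear because [a] is; the wanted lift of [N -> X] is
   [l \o b']. *)
have [b' b'E] : exists b' : {linear N -> 'rV[R]_d}, forall z, b' z = b z.
  by apply: linear_pack => c u v; apply: (can_inj aK); rewrite linearP !bK.
have klE z : p (l (b' z)) = q z by rewrite lE /= b'E bK.
have [|||j jE] := to_pullback (f := fun v => x *: v) (g := p).
- by move=> c u v; rewrite scalerDr !scalerA mulrC.
- exact: linearP.
- by move=> v; rewrite linearZ.
have [|||h hE] := to_pullback (f := i) (g := fun _ => 0).
- exact: linearP.
- by move=> c u v; rewrite scaler0 addr0.
- by move=> w; rewrite pi_comp0 scaler0.
have [|r0 r0E] := @linear_pack R 'rV[R]_n 'rV[R]_n (fun v => l (b' (j v)) - v).
  by move=> c u v; rewrite [j _]linearP [b' _]linearP [l _]linearP scalerBr opprD addrACA.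
have [|r rE] := factor_inj (f := r0) i_inj.
  by move=> v; apply/i_ker; rewrite r0E linearB klE qE jE subrr.
have [|k kE] := factor_inj (f := l \o (b' \o h)) i_inj.
  by move=> w; apply/i_ker; rewrite /= klE qE hE.
have wE w : w = x *: k w - r (i w).
  apply: i_inj; rewrite linearB linearZ /= kE rE r0E /=.
  have -> : j (i w) = x *: h w.
    apply: e_inj; rewrite linearZ jE hE pi_comp0.
    by rewrite [RHS]surjective_pairing /= scaler0.
  by rewrite !linearZ /= opprB addrC subrK.
have [d' [c c_min]] := minimal_coverP m_unit Kfg; have [c_surj _] := c_min.
have K0 : forall w : K, w = 0.
  apply: (nakayama c_min) => w.
  have [v cv] := c_surj (k w).
  have [t ct] := choice (fun l => c_surj (r (delta_mx 0 l))).
  (* Lifts [x *: k w - r (i w)] along [c], with [r (i w)] expanded over the unit vectors; the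
     coordinates of [i w] lie in [m] because [p (i w) = 0]. *)
  exists (x *: v - \sum_l i w 0 l *: t l).
    move=> l'; rewrite !mxE mulrC rpredB ?idealMr // summxE.
    apply: rpred_sum => l'' _; rewrite mxE mulrC idealMr //.
    by case: p_min => _; apply; apply: pi_comp0.
  rewrite linearB linearZ /= cv {1}(wE w) linear_sum (linear_rVE r) /=.
  by congr (_ - _); apply: eq_bigr => l' _; rewrite linearZ /= ct.
exists n; apply: iso_sym; exists p; apply: injective_surjective_bij => // u v puv.
apply/eqP; rewrite -subr_eq0; apply/eqP.
have /i_ker[w <-] : p (u - v) = 0 by rewrite linearB puv subrr.
by rewrite (K0 w) linear0.
Qed.

End Pullback.

(** One round of the construction, with freeness tracked by [free_upto] so that no localization
    appears. *)
Lemma resolving_step (R : comNzRingType) (m : idealr R) (C : lmodType R -> Prop)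
    (X X0 : lmodType R) (k : nat) (x : R) :
  (forall a, a \notin m -> exists b, b * a = 1) -> resolving C ->
  C X -> res k X0 X -> ~ free_module X -> x \in m ->
  exists N : lmodType R,
    [/\ C N, res k.+2 X0 N, ~ free_module N, free_upto x N
      & forall u, free_upto u X -> free_upto (u * u) N].
Proof.
move=> m_unit Cres CX Xk Xnf xm.
have Xfg := resolving_fin_gen Cres CX.
have [n [p p_min]] := minimal_coverP m_unit Xfg; have [p_surj _] := p_min.
have [K [i [i_inj i_ker]]] := kernel_exists p.
have [|d dE] := @linear_pack R ('rV[R]_n * X)%type X (fun z => p z.1 - x *: z.2).
  by move=> a u v; rewrite /= linearP scalerDr scalerBr !scalerA [x * a]mulrC opprD addrACA.
have [N [e [e_inj e_ker]]] := kernel_exists d.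
have e_img z : p z.1 = x *: z.2 <-> exists y, e y = z.
  by rewrite -e_ker dE; split=> [->|/eqP]; rewrite ?subrr // subr_eq0 => /eqP.
have KFX : has_ses K 'rV[R]_n X by exists i, p.
have KNX := pullback_ses p_surj i_inj i_ker e_inj e_img.
have [_ [_ _ Cext Cker]] := Cres.
have CK : C K by apply: Cker KFX _ CX; apply: resolving_rV.
have CN : C N by apply: Cext KNX CK CX.
have fg := resolving_fin_gen Cres.
exists N; split=> //.
- apply: sub_add_closure; split; first exact: fg.
  (* [X] is raised to level [k.+1], the level of its syzygy [K]. *)
  exists K, X; split; [|exact: res_succ|by left].
  apply: sub_add_closure; split; first exact: fg.
  by exists 'rV[R]_n, X; split=> //; [exact: res_rV|right].
- exact: (pullback_not_free p_surj i_inj i_ker e_inj e_img p_min m_unit xm (fg _ CK) Xnf).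
- exact: pullback_free_upto e_inj e_img.
- exact: pullback_free_upto_sqr p_surj e_inj e_img.
Qed.

(** * Freeness of localizations *)

Section Localize.
Local Notation frac := Defs.frac.
Variables (R : comNzRingType) (p : prime_idealr R).
Implicit Types (M : lmodType R) (s t u : loc_den p).

Let ring_frac (a : R) s : loc_ring p := frac (a : R^o) s.

Lemma loc_den_prod (I : finType) (P : pred I) (d : I -> loc_den p) :
  \prod_(i | P i) sval (d i) \notin p.
Proof.
elim/big_ind: _ => [|a b ap bp|i _]; first by rewrite idealr1.
  by rewrite prime_idealrM negb_or ap.
exact: (valP (d i)).
Qed.

Definition den_prod (I : finType) (P : pred I) (d : I -> loc_den p) : loc_den p :=
  @exist R (fun a => a \notin p) _ (loc_den_prod P d).

(** Take the product of all denominators and multiply each numerator by the other ones. *)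
Lemma common_den M (I : finType) (a : I -> loc p M) :
  exists (s : loc_den p) (b : I -> M), forall i, a i = frac (b i) s.
Proof.
exists (den_prod predT (fun i => den (a i))).
exists (fun i => \prod_(j | j != i) sval (den (a j)) *: num (a i)) => i.
rewrite -{1}(frac_numden (a i)); apply: frac_eq1.
by rewrite scalerA /= (bigD1 i).
Qed.

Lemma common_killer M (I : finType) (x : I -> M) :
  (forall i, exists u, sval u *: x i = 0) ->
  exists u, forall i, sval u *: x i = 0.
Proof.
move=> /choice[d dx]; exists (den_prod predT d) => i.
by rewrite /= (bigD1 i) //= mulrC -scalerA dx scaler0.
Qed.

Lemma frac_eq0 M (x : M) s : frac x s = 0 <-> exists u, sval u *: x = 0.
Proof.
split=> [/frac_eqP[u]|[u ux]]; first by rewrite scaler0 mulr1; exists u.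
by apply/frac_eqP; exists u; rewrite mulr1 scaler0.
Qed.

Lemma fracD M (x y : M) s : frac x s + frac y s = frac (x + y) s.
Proof.
rewrite [LHS]frac_add; apply: frac_eq1 => /=.
by rewrite -scalerDr scalerA.
Qed.

Lemma frac_sum M (I : finType) (x : I -> M) s :
  \sum_i frac (x i) s = frac (\sum_i x i) s.
Proof.
apply/esym; apply: (big_morph (fun x : M => frac x s)) => [y z|]; first by rewrite fracD.
by apply/frac_eq0; exists s; rewrite scaler0.
Qed.

Lemma fracZ M (a : R) s (x : M) t : ring_frac a s *: frac x t = frac (a *: x) (denM s t).
Proof. exact: frac_scale. Qed.

Lemma fracZ1 M (a : R) (x : M) t : ring_frac a (den1 p) *: frac x t = frac (a *: x) t.
Proof. by rewrite fracZ; apply: frac_eq1; rewrite /= mul1r. Qed.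

Lemma ring_fracM (a b : R) s t : ring_frac a s * ring_frac b t = ring_frac (a * b) (denM s t).
Proof. exact: frac_mul. Qed.

(** The basis consists of the [f (delta_mx 0 i) / 1], and the inverse sends [x / t] to
    [g x / (u t)]. *)
Lemma free_upto_loc (u : R) M : u \notin p -> free_upto u M -> free_module (loc p M).
Proof.
move=> up [n [f [g [gf fg]]]]; exists n; apply: iso_sym.
pose du : loc_den p := @exist R (fun a => a \notin p) u up.
have [F FE] := @linear_of_family (loc_ring p) n (loc p M)
  (fun i => frac (f (delta_mx 0 i)) (den1 p)).
have Ffrac (a : 'rV[R]_n) s : F (\row_i ring_frac (a 0 i) s) = frac (f a) s.
  rewrite FE (linear_rVE f a) -frac_sum; apply: eq_bigr => i _.
  by rewrite mxE fracZ; apply: frac_eq1; rewrite /= mulr1.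
exists F; apply: injective_surjective_bij => [v w Fvw|z]; last first.
  exists (\row_i ring_frac (g (num z) 0 i) (denM du (den z))).
  rewrite Ffrac fg -[RHS]frac_numden; apply: frac_eq1.
  by rewrite /= scalerA mulrC.
apply/eqP; rewrite -subr_eq0; apply/eqP.
have {Fvw} : F (v - w) = 0 by rewrite linearB Fvw subrr.
move: (v - w) => {v w} v.
(* A kernel vector is some [a / s]; then [t *: f a = 0] with [t] outside [p], and applying [g] shows
   that [t * u] kills [a]. *)
have [s [a vE]] := @common_den R^o 'I_n (fun i => v 0 i).
have -> : v = \row_i ring_frac ((\row_j (a j : R)) 0 i) s.
  by apply/rowP => i; rewrite !mxE; apply: vE.
rewrite Ffrac => /frac_eq0[t /(congr1 g)].
rewrite linear0 linearZ /= gf scalerA => /rowP ta0.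
apply/rowP => i; rewrite [LHS]mxE [RHS]mxE; apply/frac_eq0; exists (denM t du).
by have := ta0 i; rewrite !mxE.
Qed.

(** Clearing denominators in an isomorphism [h] from [loc p M] to a free module and in its inverse
    gives [psi] from [M] and [theta] to [M]. Both composites are a scalar [r] after localization; by
    finite generation one more factor outside [p] makes this exact. *)
Lemma loc_free_upto M n (q : {linear 'rV[R]_n -> M}) (K : lmodType R)
    (i : {linear K -> 'rV[R]_n}) :
  (forall y, exists v, q v = y) -> (forall v, q v = 0 <-> exists w, i w = v) ->
  fin_gen K -> free_module (loc p M) -> exists2 u, u \notin p & free_upto u M.
Proof.
move=> q_surj i_ker /fin_gen_surj[d [c c_surj]] [k [h h_bij]].
have [h' hK h'K] := h_bij; have h_inj := can_inj hK.
pose lf (N : lmodType R) (x : N) : loc p N := frac x (den1 p).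
have lf_lin l (f : {linear 'rV[R]_l -> M}) v :
    lf M (f v) = \sum_j ring_frac (v 0 j) (den1 p) *: lf M (f (delta_mx 0 j)).
  rewrite (linear_rVE f v) /lf -frac_sum; apply: eq_bigr => j _.
  by rewrite fracZ1.
have [s [a aE]] := @common_den R^o ('I_n * 'I_k)%type
  (fun z => h (lf M (q (delta_mx 0 z.1))) 0 z.2).
have {}aE l j : h (lf M (q (delta_mx 0 l))) 0 j = ring_frac (a (l, j)) s := aE (l, j).
have [A AE] := linear_of_family (fun l => \row_j (a (l, j) : R)).
have hA v j : h (lf M (q v)) 0 j = ring_frac (A v 0 j) s.
  rewrite lf_lin linear_sum summxE AE summxE -[RHS](@frac_sum R^o).
  apply: eq_bigr => l _; rewrite linearZ /= !mxE aE ring_fracM.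
  by apply: frac_eq1R => /=; ring.
(* [A] kills the relations of [M] only after localization. As [K] is finitely generated, a single
   [t] makes [t A] kill them all and descend to [M]. *)
have [t tA] : exists t, forall z : 'I_d * 'I_k,
    sval t *: (A (i (c (delta_mx 0 z.1))) 0 z.2 : R^o) = 0.
  apply: common_killer => -[l j] /=; apply/(@frac_eq0 R^o _ s).
  rewrite -[LHS]hA; have -> : q (i (c (delta_mx 0 l))) = 0.
    by apply/i_ker; exists (c (delta_mx 0 l)).
  have -> : lf M 0 = 0 by apply/frac_eq0; exists s; rewrite scaler0.
  by rewrite linear0 mxE.
have [|tA' tA'E] := @linear_pack R 'rV[R]_n 'rV[R]_k (fun v => sval t *: A v).
  by move=> r x y; rewrite [A _]linearP scalerDr !scalerA mulrC.
have [|psi psiE] := factor_surj (f := tA') q_surj.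
  move=> v /i_ker[w <-]; have [x <-] := c_surj w.
  rewrite tA'E; apply/rowP => j; rewrite (linear_rVE c) !linear_sum /=.
  rewrite summxE [RHS]mxE big1 // => l _.
  have tlj : sval t * A (i (c (delta_mx 0 l))) 0 j = 0 := tA (l, j).
  by rewrite !linearZ /= !mxE ?(mulrCA (sval t)) tlj mulr0.
have hpsi x j : h (lf M x) 0 j = ring_frac (psi x 0 j) (denM t s).
  have [v <-] := q_surj x; rewrite hA psiE tA'E mxE.
  by apply: frac_eq1R => /=; ring.
have [s' [y yE]] := @common_den M 'I_k (fun j => h' (delta_mx 0 j)).
have [theta thetaE] := linear_of_family y.
have hy l : h (lf M (y l)) = ring_frac (sval s') (den1 p) *: delta_mx 0 l.
  rewrite -[delta_mx 0 l]h'K -linearZ /= yE fracZ; congr (h _).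
  by apply: frac_eq1; rewrite /= mul1r scale1r.
have lf_theta v : lf M (theta v) = \sum_j ring_frac (v 0 j) (den1 p) *: lf M (y j).
  by rewrite thetaE /lf -frac_sum; apply: eq_bigr => j _; rewrite fracZ1.
have htheta v j : h (lf M (theta v)) 0 j = ring_frac (sval s' * v 0 j) (den1 p).
  rewrite lf_theta linear_sum summxE (bigD1 j) //= big1 ?addr0 => [|l lj].
    rewrite linearZ /= hy !mxE !eqxx mulr1 ring_fracM.
    by apply: frac_eq1R => /=; ring.
  by rewrite linearZ /= hy !mxE [j == l]eq_sym (negPf lj) !mulr0.
(* After localization [psi] is [t s] times [h], and [theta] is [s'] times its inverse. *)
pose r := sval t * sval s * sval s'.
have lf_psi x : lf M (theta (psi x)) = lf M (r *: x).
  apply: h_inj; apply/rowP => j; rewrite htheta /lf -fracZ1 linearZ /= mxE hpsi ring_fracM.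
  by apply: frac_eq1R => /=; rewrite /r; ring.
have [|D1 D1E] := @linear_pack R 'rV[R]_k 'rV[R]_k (fun v => psi (theta v) - r *: v).
  move=> b v w; rewrite [theta _]linearP [psi _]linearP.
  by rewrite !scalerDr scalerN opprD addrACA !scalerA [r * b]mulrC.
have [|D2 D2E] := @linear_pack R 'rV[R]_n M (fun v => theta (psi (q v)) - r *: q v).
  move=> b v w; rewrite [q _]linearP [psi _]linearP [theta _]linearP.
  by rewrite !scalerDr scalerN opprD addrACA !scalerA [r * b]mulrC.
have [u1 u1P] : exists u, forall l : 'I_k, sval u *: D1 (delta_mx 0 l) = 0.
  apply: common_killer => l.
  have [j|u uP] := @common_killer R^o _ (fun j => D1 (delta_mx 0 l) 0 j); last first.
    by exists u; apply/rowP => j; rewrite !mxE; apply: uP.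
  have := htheta (delta_mx 0 l) j; rewrite hpsi => /frac_eqP[u uE].
  have {}uE : sval u * 1 * psi (theta (delta_mx 0 l)) 0 j
      = sval u * (sval t * sval s) * (sval s' * (delta_mx 0 l : 'rV[R]_k) 0 j) := uE.
  exists u; rewrite D1E 2!mxE [X in _ - X]mxE /GRing.scale /= mulrBr -{1}[sval u]mulr1 uE.
  by rewrite /r; ring.
have [u2 u2P] : exists u, forall l : 'I_n, sval u *: D2 (delta_mx 0 l) = 0.
  apply: common_killer => l; have /frac_eqP[u uE] := lf_psi (q (delta_mx 0 l)).
  by exists u; rewrite D2E scalerBr -[sval u]mulr1 uE subrr.
exists (sval u1 * sval u2 * r).
  by rewrite !prime_idealrM !negb_or (valP u1) (valP u2) (valP t) (valP s) (valP s').
exists k, theta.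
have [|g gE] := @linear_pack R M 'rV[R]_k (fun x => (sval u1 * sval u2) *: psi x).
  by move=> b x z; rewrite linearP scalerDr !scalerA mulrC.
exists g; split=> [v|x].
  rewrite gE; apply/eqP; rewrite -[_ * r *: v]scalerA -subr_eq0 -scalerBr -D1E; apply/eqP.
  rewrite (linear_rVE D1) scaler_sumr big1 // => l _.
  by rewrite scalerA -mulrA mulrC -scalerA u1P scaler0.
have [v <-] := q_surj x.
rewrite gE linearZ /=; apply/eqP; rewrite -[_ * r *: _]scalerA -subr_eq0 -scalerBr -D2E; apply/eqP.
rewrite (linear_rVE D2) scaler_sumr big1 // => l _.
by rewrite scalerA mulrAC -scalerA u2P scaler0.
Qed.

End Localize.

(** * Ideals of Noetherian local rings *)

Section Ideals.
Variable R : comNzRingType.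
Implicit Types (I J : R -> Prop) (p q : prime_idealr R).

(** Unlike [idealr], this admits the unit ideal, which [adjoin] may produce. *)
Definition is_ideal I : Prop :=
  I 0 /\ forall a u v, I u -> I v -> I (a * u + v).

Lemma idealrP (m : idealr R) : is_ideal (fun x => x \in m).
Proof. by split=> [|a u v um vm]; [exact: idealr0|rewrite rpredD ?idealMr]. Qed.

Definition adjoin I a : R -> Prop := fun x => exists r, I (x - r * a).

Lemma adjoin_ideal I a : is_ideal I -> is_ideal (adjoin I a).
Proof.
move=> [I0 ID]; split=> [|c u v [r Iu] [s Iv]]; first by exists 0; rewrite mul0r subrr.
exists (c * r + s); have := ID c _ _ Iu Iv.
by congr (I _); ring.
Qed.

Lemma sub_adjoin I a x : I x -> adjoin I a x.
Proof. by exists 0; rewrite mul0r subr0. Qed.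

Lemma mem_adjoin I a : is_ideal I -> adjoin I a a.
Proof. by move=> [I0 _]; exists 1; rewrite mul1r subrr. Qed.

Lemma adjoin_min I a p : (forall x, I x -> x \in p) -> a \in p ->
  forall x, adjoin I a x -> x \in p.
Proof.
move=> Ip ap x [r /Ip xr]; rewrite -(subrK (r * a) x) rpredD //.
exact: idealMr.
Qed.

Let asbool_idealr_closed I : is_ideal I -> ~ I 1 ->
  idealr_closed ((fun x => `[< I x >]) : {pred R}).
Proof.
move=> [I0 ID] I1; split; first exact/asboolP; first exact/asboolP.
by move=> a u v; rewrite !unfold_in => /asboolP Iu /asboolP Iv; apply/asboolP/ID.
Qed.

Lemma ideal_idealr I : is_ideal I -> ~ I 1 ->
  exists m : idealr R, forall x, x \in m <-> I x.
Proof.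
move=> Iid I1; pose P : {pred R} := fun x => `[< I x >].
pose m : idealr R := HB.pack (P : R -> bool) (isIdealr.Build R P (asbool_idealr_closed Iid I1)).
by exists m => x; split=> [/asboolP|] // Ix; apply/asboolP.
Qed.

Lemma ideal_prime I : is_ideal I -> ~ I 1 ->
  (forall u v, I (u * v) -> I u \/ I v) ->
  exists p, forall x, x \in p <-> I x.
Proof.
move=> Iid I1 Ipr; pose P : {pred R} := fun x => `[< I x >].
have Pprime : prime_idealr_closed P.
  by move=> u v /asboolP/Ipr[Iu|Iv]; apply/orP; [left|right]; apply/asboolP.
pose p : prime_idealr R := HB.pack (P : R -> bool)
  (isIdealr.Build R P (asbool_idealr_closed Iid I1))
  (isPrimeIdealrClosed.Build R P Pprime).
by exists p => x; split=> [/asboolP|] // Ix; apply/asboolP.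
Qed.

Lemma prime_avoidance J (ps : seq (prime_idealr R)) : is_ideal J ->
  exists x, J x /\ forall p, List.In p ps -> (exists a, J a /\ a \notin p) -> x \notin p.
Proof.
move=> Jid; have [J0 JD] := Jid.
elim: {ps}_.+1 {-2}ps (ltnSn (size ps)) => // n IHn [|p ps] /=; first by exists 0.
rewrite ltnS => ps_n; have [x [Jx x_ps]] := IHn ps ps_n.
have [[a [Ja ap]]|Jp] := pselect (exists a, J a /\ a \notin p); last first.
  by exists x; split=> // q [<- /Jp|/x_ps].
have [xp|xp] := boolP (x \in p); last first.
  by exists x; split=> // q [<-|/x_ps].
have [[q [q_ps qp]]|ps_p] :=
    pselect (exists q, List.In q ps /\ forall b, b \in q -> b \in p).
  have [l1 [l2 ps_eq]] := List.in_split q ps q_ps.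
  have [|y [Jy y_ps]] := IHn (p :: l1 ++ l2).
    by rewrite (leq_trans _ ps_n) // ps_eq /= !size_cat /= addnS.
  have yp : y \notin p by apply: y_ps; [left|exists a].
  exists y; split=> // q' [<-|] //; rewrite ps_eq => /List.in_app_iff q'_ps Jq'.
  have [/y_ps|<-] : List.In q' (p :: l1 ++ l2) \/ q = q'.
  - case: q'_ps => [h|[->|h]]; [left|by right|left]; right; apply/List.in_app_iff.
      by left.
    by right.
  - exact.
  - by apply: contra yp; apply: qp.
have [b [bp b_ps]] : exists b, b \notin p /\ forall q, List.In q ps -> b \in q.
  elim: ps ps_p {x_ps ps_n IHn} => [|q ps IHps] ps_p.
    by exists 1; split=> //; rewrite idealr1.
  have [|b [bp b_ps]] := IHps.
    by move=> [q' [q'_ps qp]]; apply: ps_p; exists q'; split=> //; right.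
  have [c cq cp] : exists2 c, c \in q & c \notin p.
    apply: contrapT => qp; apply: ps_p; exists q; split=> [|c cq]; first by left.
    by apply/negPn/negP => cp; apply: qp; exists c.
  exists (b * c); split=> [|q' [<-|/b_ps bq']]; first by rewrite prime_idealrM negb_or bp.
    exact: idealMr.
  by rewrite mulrC idealMr.
(* Modulo [p] this is [b * a]; modulo each prime of [ps] it is [x]. *)
exists (b * a + x); split; first exact: JD.
move=> q [<- _|q_ps Jq].
  by rewrite rpredDr // prime_idealrM negb_or bp.
by rewrite rpredDl ?x_ps // mulrC idealMr // b_ps.
Qed.

Hypothesis R_noeth : noetherian R.

Lemma ideal_fin_gen I : is_ideal I -> exists s : seq R, forall x,
  I x <-> spanned (s : seq R^o) x.
Proof.
move=> [I0 ID]; pose P : {pred R^o} := fun x => `[< I x >].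
have Pid : submod_closed P.
  split=> [|a u v]; first exact/asboolP.
  by rewrite !unfold_in => /asboolP Iu /asboolP Iv; apply/asboolP/ID.
pose Q : submodClosed R^o := HB.pack (P : R^o -> bool)
  (GRing.isSubmodClosed.Build R R^o P (GRing.submod_closed_semi Pid)).
have [s sE] := R_noeth Q; exists s => x; rewrite -sE.
by split=> [Ix|/asboolP //]; apply/asboolP.
Qed.

(** A counterexample starts a strictly increasing sequence of ideals. Its union is finitely
    generated, so some stage [M] contains all generators and cannot grow further. *)
Lemma noetherian_ind (P : (R -> Prop) -> Prop) :
  (forall I, is_ideal I ->
     (forall J, is_ideal J -> (forall x, I x -> J x) -> (exists x, J x /\ ~ I x) -> P J) ->
     P I) ->
  forall I, is_ideal I -> P I.
Proof.
move=> P_step I Iid; apply: contrapT => nPI.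
pose T := {J | is_ideal J /\ ~ P J}.
have next (t : T) : exists t' : T, (forall x, sval t x -> sval t' x) /\
    exists x, sval t' x /\ ~ sval t x.
  case: t => [J [Jid nPJ]]; apply: contrapT => noJ; apply/nPJ/P_step => // J' J'id JJ' [x J'x].
  apply: contrapT => nPJ'; apply: noJ.
  by exists (exist _ J' (conj J'id nPJ')); split=> //; exists x.
have [F FP] := choice next.
pose c n := iter n F (exist _ I (conj Iid nPI)).
have c_mono n k x : (n <= k)%N -> sval (c n) x -> sval (c k) x.
  move=> nk cx; rewrite -(subnK nk); elim: (k - n)%N => // d IHd.
  by rewrite addSn; apply: (FP _).1.
have c_id n : is_ideal (sval (c n)) by case: (svalP (c n)).
have [|s sE] := @ideal_fin_gen (fun x => exists n, sval (c n) x).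
  split=> [|a u v [n cu] [k cv]]; first by exists 0%N; case: (c_id 0%N).
  exists (maxn n k); apply: (c_id _).2; first exact: c_mono (leq_maxl _ _) cu.
  exact: c_mono (leq_maxr _ _) cv.
have gen (i : 'I_(size s)) : exists n, sval (c n) s`_i.
  apply/sE; exists (fun j => (j == i)%:R).
  rewrite (bigD1 i) //= eqxx scale1r big1 ?addr0 // => j /negPf ->.
  by rewrite scale0r.
have [N NP] := choice gen; pose M := (\max_i N i)%N.
have [x [cx]] := (FP (c M)).2; apply.
have [h [c0 cD]] : spanned (s : seq R^o) x /\ is_ideal (sval (c M)).
  by split=> //; apply/sE; exists M.+1.
case: h => b ->; elim/big_ind: _ => // [u v cu cv|i _]; first by rewrite -[u]mul1r; apply: cD.
by rewrite -[_ *: _]addr0; apply: cD => //; apply: c_mono (NP i); apply: leq_bigmax.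
Qed.

(** The list contains the minimal primes over [I]. If [u * v] is in [I] but [u] and [v] are not,
    every prime over [I] contains [adjoin I u] or [adjoin I v], and the two lists are joined. *)
Lemma finite_primes I : is_ideal I ->
  exists ps : seq (prime_idealr R),
    (forall p, List.In p ps -> forall x, I x -> x \in p) /\
    (forall q, (forall x, I x -> x \in q) ->
       exists p, List.In p ps /\ forall x, x \in p -> x \in q).
Proof.
elim/noetherian_ind => {I} I Iid IHI.
have [I1|I1] := pselect (I 1).
  by exists [::]; split=> // q /(_ 1 I1); rewrite idealr1.
have [Ipr|] := pselect (forall u v, I (u * v) -> I u \/ I v).
  have [p pE] := ideal_prime Iid I1 Ipr; exists [:: p]; split=> [_ [<-|//] x /pE //|q Iq].
  by exists p; split=> [|x /pE/Iq //]; left.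
move=> /existsNP[u /existsNP[v /not_implyP[Iuv /not_orP[Iu Iv]]]].
have adj a : ~ I a -> exists ps : seq (prime_idealr R),
    (forall p, List.In p ps -> forall x, adjoin I a x -> x \in p) /\
    (forall q, (forall x, adjoin I a x -> x \in q) ->
       exists p, List.In p ps /\ forall x, x \in p -> x \in q).
  move=> Ia; apply: IHI; [exact: adjoin_ideal|exact: sub_adjoin|].
  by exists a; split=> //; apply: mem_adjoin.
have [[ps [psI ps_min]] [qs [qsI qs_min]]] := (adj _ Iu, adj _ Iv).
exists (ps ++ qs); split=> [p /List.in_app_iff[/psI h|/qsI h] x Ix|q Iq].
- exact/h/sub_adjoin.
- exact/h/sub_adjoin.
have /orP[uq|vq] : (u \in q) || (v \in q) by rewrite -prime_idealrM Iq.
- have [p [p_ps pq]] := ps_min q (adjoin_min Iq uq).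
  by exists p; split=> //; apply/List.in_app_iff; left.
- have [p [p_qs pq]] := qs_min q (adjoin_min Iq vq).
  by exists p; split=> //; apply/List.in_app_iff; right.
Qed.

Variable m : idealr R.
Hypothesis R_local : local_ring m.

(** Noetherian induction in place of Zorn's lemma: a proper [I] without larger proper ideals is
    maximal, hence is [m]. *)
Lemma ideal_sub_local I : is_ideal I -> ~ I 1 -> forall x, I x -> x \in m.
Proof.
elim/noetherian_ind => {I} I Iid IHI I1 x Ix.
have [[J [Jid IJ [y Jy] J1]]|noJ] := pselect (exists J, [/\ is_ideal J,
  forall x, I x -> J x, exists y, J y /\ ~ I y & ~ J 1]).
  by apply: (IHI J Jid IJ _ J1) (IJ x Ix); exists y.
have [J JE] := ideal_idealr Iid I1; rewrite -(R_local.2 J); first exact/JE.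
move=> J' JJ' y J'y; apply/JE; apply: contrapT => Iy; apply: noJ.
exists (fun x => x \in J'); split=> [|z /JE/JJ' //||]; first exact: idealrP.
  by exists y.
by rewrite idealr1.
Qed.

Lemma local_unit a : a \notin m -> exists b, b * a = 1.
Proof.
move=> am; apply: contrapT => na; case/negP: am.
apply: (@ideal_sub_local (fun x => exists b, b * a = x)) => //; last by exists 1; rewrite mul1r.
split=> [|c u v [r <-] [s <-]]; first by exists 0; rewrite mul0r.
by exists (c * r + s); ring.
Qed.

Lemma prime_sub_local p x : x \in p -> x \in m.
Proof. by apply: (ideal_sub_local (idealrP p)); rewrite idealr1. Qed.

(** Makes [m], given as a mere proper ideal, a point of the spectrum; it is prime because a product
    of units is a unit. *)
Lemma local_prime : exists p, p =i m.
Proof.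
have [|||p pE] := @ideal_prime (fun x => x \in m); first exact: idealrP.
- by rewrite idealr1.
- move=> u v uv; apply: contrapT => /not_orP[/negP/local_unit[b bu] /negP/local_unit[c cv]].
  have := idealMr (b * c) uv; have -> : b * c * (u * v) = (b * u) * (c * v) by ring.
  by rewrite bu cv mulr1 idealr1.
- by exists p => x; apply/idP/idP => /pE.
Qed.

(** Let [x] avoid those primes of [finite_primes] that do not contain [m]. Below [q] there is a
    listed [p]: if it contains [m], then [q] is [m]; otherwise [x] lies in [q] but not in [p]. *)
Lemma local_parameter I : is_ideal I ->
  exists x, x \in m /\ forall q, (forall y, I y -> y \in q) -> x \in q ->
    q =i m \/ exists p, [/\ forall y, I y -> y \in p, {subset p <= q} & ~ {subset q <= p}].
Proof.
move=> Iid; have [ps [psI ps_min]] := finite_primes Iid.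
have [x [xm x_ps]] := prime_avoidance ps (idealrP m).
exists x; split=> // q Iq xq; have [p [p_ps pq]] := ps_min q Iq.
have [[a [am ap]]|mp] := pselect (exists a, a \in m /\ a \notin p).
  right; exists p; split=> //; first exact: psI.
  by move=> /(_ x xq); apply/negP/x_ps => //; exists a.
left=> y; apply/idP/idP => [/prime_sub_local //|ym]; apply: pq.
by apply/negPn/negP => yp; apply: mp; exists y.
Qed.

End Ideals.

(** * Dimension and steps *)

Section Dimension.

(** [supremum] is known to bound a set only once a least upper bound exists. Here that is the least
    natural upper bound, or [+oo] if no natural number is one. *)
Lemma ereal_int_supremum (A : set (\bar int)) t :
  (forall a, A a -> (0%:E <= a)%E) -> A t -> (t <= supremum -oo%E A)%E.
Proof.
move=> A0 At; apply: ge_supremum_Nmem => //.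
have [[d dub]|nub] := pselect (exists d : nat, ubound A (d%:Z)%:E); last first.
  exists +oo%E; split=> [a _|b bub]; first exact: leey.
  case: b bub (A0 _ At) => [b|//|] bub t0.
  - exfalso; apply: nub; exists `|b|%N => a /bub /le_trans; apply.
    by rewrite lee_fin lez_abs.
  - by have := le_trans t0 (bub _ At).
have exd : exists d : nat, `[< ubound A (d%:Z)%:E >] by exists d; apply/asboolP.
have [e /asboolP eub e_min] := ex_minnP exd; exists (e%:Z)%:E; split=> // b bub.
have b0 := le_trans (A0 _ At) (bub _ At).
case: b bub b0 => [b bub b0|_ _|//]; last exact: leey.
have {}b0 : 0 <= b by rewrite -lee_fin.
have := e_min `|b|%N; rewrite gez0_abs // => /(_ (asboolT bub)) eb.
by rewrite lee_fin -(gez0_abs b0) lez_nat.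
Qed.

Lemma step_le (R : comNzRingType) (X Y : lmodType R) n :
  res n X Y -> (step X Y <= (n%:Z)%:E)%E.
Proof.
move=> XYn; apply: le_infimum_Nmem; last by exists n.
have exn : exists n, `[< res n X Y >] by exists n; apply/asboolP.
have [e /asboolP eres e_min] := ex_minnP exn; exists (e%:Z)%:E.
split=> [_ [k kres <-]|b]; last by apply; exists e.
by rewrite lee_fin lez_nat e_min //; apply/asboolP.
Qed.

Variable R : comNzRingType.
Implicit Types p q : prime_idealr R.

(** Describes chains of primes of R/p inside R. The inclusion is asked at every index, also past
    [n], so that each [q i] has an image in R/p. *)
Definition chain_above n p : Prop :=
  exists q : nat -> prime_idealr R, (forall i, {subset p <= q i}) /\ prime_chain n q.

Lemma quot_prime_chain n p : chain_above n p ->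
  exists Q : nat -> prime_idealr {ideal_quot p}, prime_chain n Q.
Proof.
move=> [q [pq q_chain]].
(* Membership in [q i] is independent of the representative since [q i] contains [p]. *)
have reprP i x : (repr (\pi_{ideal_quot p} x)%qT \in q i) = (x \in q i).
  rewrite -[in RHS](subrK (repr (\pi_{ideal_quot p} x)%qT) x) rpredDl //.
  by apply: (pq i); rewrite Quotient.idealrBE reprK.
have ex_prime i : exists Q : prime_idealr {ideal_quot p},
    forall x, \pi_{ideal_quot p}%qT x \in Q <-> x \in q i.
  have [|||Q QE] := @ideal_prime _ (fun z : {ideal_quot p} => repr z \in q i).
  - split=> [|a u v]; first by rewrite -(rmorph0 (\pi_{ideal_quot p}%qT)) reprP rpred0.
    rewrite -[a]reprK -[u]reprK -[v]reprK -rmorphM -rmorphD !reprP => uq vq.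
    by rewrite rpredD ?idealMr.
  - by rewrite -(rmorph1 (\pi_{ideal_quot p}%qT)) reprP idealr1.
  - move=> u v; rewrite -[u]reprK -[v]reprK -rmorphM !reprP prime_idealrM.
    by move/orP.
  by exists Q => x; rewrite QE reprP.
have [Q QE] := choice ex_prime; exists Q => i /q_chain[qi qi']; split=> [z|].
  by rewrite -[z]reprK => /QE/qi zq; apply/QE.
by move=> Qi; apply: qi' => x /QE/Qi/QE.
Qed.

Lemma chain_above0 p : chain_above 0 p.
Proof. by exists (fun _ => p); split=> [i x|i]. Qed.

Lemma chain_aboveS n p q : {subset p <= q} -> ~ {subset q <= p} ->
  chain_above n q -> chain_above n.+1 p.
Proof.
move=> pq qp [c [qc c_chain]]; exists (fun i => if i is j.+1 then c j else p).
split=> [[|i] x xp //|[|i]]; first exact/qc/pq.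
  by split=> [x xp|cp]; [exact/qc/pq|apply: qp => x /qc/cp].
by rewrite ltnS => /c_chain.
Qed.

Lemma krull_dim_ge n p : chain_above n p -> ((n%:Z)%:E <= krull_dim {ideal_quot p})%E.
Proof.
move=> /quot_prime_chain[Q Qn]; apply: ereal_int_supremum => [_ [k _ <-]|].
  by rewrite lee_fin.
by exists n => //; exists Q.
Qed.

(** Turns a finite dimension of the locus into a bound on the lengths of chains. *)
Lemma dim_locus_ge (Z : prime_idealr R -> Prop) n p :
  Z p -> chain_above n p -> ((n%:Z)%:E <= dim_locus Z)%E.
Proof.
move=> Zp pn; apply: (le_trans (krull_dim_ge pn)).
apply: ereal_int_supremum; last by exists p.
by move=> _ [q _ ->]; apply: (krull_dim_ge (chain_above0 q)).
Qed.

End Dimension.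

(** * Nonfree loci *)

Section PuncturedSpectrum.
Variables (R : comNzRingType) (m : idealr R) (C : lmodType R -> Prop).
Hypothesis R_noeth : noetherian R.
Hypothesis R_local : local_ring m.
Hypothesis C_res : resolving C.
Implicit Types X Y : lmodType R.

Let m_unit := local_unit R_noeth R_local.

(** Finite presentation comes from [C]: the kernel of a cover of [X] lies in [C] again, so it is
    finitely generated. *)
Lemma free_locP X (p : prime_idealr R) : C X ->
  free_module (loc p X) <-> exists2 u, u \notin p & free_upto u X.
Proof.
move=> CX; split=> [|[u]]; last exact: free_upto_loc.
have /fin_gen_surj[n [q q_surj]] := resolving_fin_gen C_res CX.
have [K [i [i_inj i_ker]]] := kernel_exists q.
apply: (loc_free_upto q_surj i_ker).
have [_ [_ _ _ Cker]] := C_res.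
apply: (resolving_fin_gen C_res); apply: Cker CX; last exact: resolving_rV.
by exists i, q.
Qed.

Lemma NF_max X (p : prime_idealr R) : p =i m -> ~ free_module X -> C X -> NF X p.
Proof.
move=> pm Xnf CX /(free_locP _ CX)[u]; rewrite pm => /m_unit[b bu] Xu.
by apply/Xnf/free_free_upto1; rewrite -bu; apply: free_upto_mull.
Qed.

(** The intersection of the primes in [NF X]; for [X] in [C] its zero set is [NF X], by
    [NF_closed]. *)
Definition NF_ideal X : R -> Prop := fun a => forall p, NF X p -> a \in p.

Lemma NF_ideal_ideal X : is_ideal (NF_ideal X).
Proof.
split=> [p _|a u v uX vX p Xp]; first exact: rpred0.
by rewrite rpredD ?idealMr ?uX ?vX.
Qed.

(** If [X] is free up to some [u] outside [q], every prime of [NF X] contains [u], so [u] is in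
    [NF_ideal X] and hence in [q]. *)
Lemma NF_closed X (q : prime_idealr R) : C X ->
  (forall a, NF_ideal X a -> a \in q) -> NF X q.
Proof.
move=> CX Xq /(free_locP _ CX)[u uq Xu]; case/negP: uq; apply: Xq => p Xp.
by apply/negPn/negP => up; apply: Xp; apply/(free_locP _ CX); exists u.
Qed.

Lemma NF_step k X X0 x : C X -> res k X0 X -> ~ free_module X -> x \in m ->
  exists N : lmodType R, [/\ C N, res k.+2 X0 N, ~ free_module N
    & forall p, NF N p -> x \in p /\ NF X p].
Proof.
move=> CX Xk Xnf xm.
have [N [CN Nk Nnf Nx NX]] := resolving_step m_unit C_res CX Xk Xnf xm.
exists N; split=> // p Np; split=> [|/(free_locP _ CX)[u up Xu]].
  by apply/negPn/negP => xp; apply: Np; apply/(free_locP _ CN); exists x.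
apply: Np; apply/(free_locP _ CN); exists (u * u); last exact: NX.
by rewrite prime_idealrM negb_or up.
Qed.

Lemma free_on_punctured_spectrum_exists X : C X -> ~ free_module X ->
  exists X' : lmodType R,
    [/\ C X', ~ free_module X' & free_on_punctured_spectrum m X'].
Proof.
have step I : is_ideal I -> forall Y, C Y -> ~ free_module Y ->
    (forall p a, NF Y p -> I a -> a \in p) -> exists X' : lmodType R,
    [/\ C X', ~ free_module X' & free_on_punctured_spectrum m X'].
  elim/(noetherian_ind R_noeth) => {I} I Iid IHI Y CY Ynf YI.
  have [[x [xm Ix]]|mI] := pselect (exists x, x \in m /\ ~ I x).
    have [N [CN _ Nnf Nx]] := NF_step CY (res_self Y) Ynf xm.
    apply: (IHI (adjoin I x) _ _ _ N) => //; first exact: adjoin_ideal.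
    - exact: sub_adjoin.
    - by exists x; split=> //; apply: mem_adjoin.
    by move=> p a /Nx[xp Yp]; apply: adjoin_min => // b; apply: YI.
  (* Now [I] contains [m], so every prime of [NF Y] contains [m] and equals it. *)
  exists Y; split=> // p pm; apply: contrapT => Yp; apply: pm => a.
  apply/idP/idP => [/(prime_sub_local R_noeth R_local) //|am].
  by apply: YI Yp _; apply: contrapT => Ia; apply: mI; exists a.
move=> CX Xnf; apply: (step (NF_ideal X) (NF_ideal_ideal X) X) => //.
by move=> p a Xp; apply.
Qed.

(** The dimension enters as a bound [d] on chains above primes of [NF X]. Each use of [NF_step]
    lowers it by one and adds two to the level, whence [d.*2] and the general [k]. *)
Lemma free_on_punctured_spectrum_res d k X X0 : C X -> res k X0 X -> ~ free_module X ->
  (forall p n, NF X p -> chain_above n p -> (n <= d)%N) ->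
  exists X' : lmodType R, [/\ C X', ~ free_module X', res (k + d.*2) X0 X'
    & free_on_punctured_spectrum m X'].
Proof.
have [pm pmE] := local_prime R_noeth R_local.
have sub_m (p : prime_idealr R) : {subset p <= pm}.
  by move=> a /(prime_sub_local R_noeth R_local); rewrite pmE.
elim: d k X => [|d IHd] k X CX Xk Xnf Xd.
  (* For [d = 0], a prime of [NF X] other than [m] would start a chain of length one. *)
  exists X; rewrite addn0; split=> // p pm'; apply: contrapT => Xp.
  have [mp|/(chain_aboveS (sub_m p))/(_ (chain_above0 pm))/(Xd _ _ Xp)] :=
    pselect {subset pm <= p}; last by [].
  by apply: pm' => a; rewrite -pmE; apply/idP/idP => [/sub_m|/mp].
have [x [xm xP]] := local_parameter R_noeth R_local (NF_ideal_ideal X).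
have [N [CN Nk Nnf Nx]] := NF_step CX Xk Xnf xm.
have -> : (k + d.+1.*2 = k.+2 + d.*2)%N by rewrite doubleS !addnS.
apply: IHd CN Nk Nnf _ => p n /Nx[xp Xp] pn.
have Ip a : NF_ideal X a -> a \in p by apply.
(* Either [p] is [m], above which chains have length zero, or a prime of [NF X] strictly below [p]
   lengthens the chain by one. *)
have [pm'|[p' [Xp' p'p pp']]] := xP p Ip xp; last first.
  by have := Xd _ _ (NF_closed CX Xp') (chain_aboveS p'p pp' pn).
case: n pn => // n [q [pq q_chain]]; have [_] := q_chain 0%N isT; case=> a aq.
by apply: pq; rewrite pm' -pmE; apply: sub_m aq.
Qed.

End PuncturedSpectrum.

Theorem theoremA (R : comNzRingType) (m : idealr R)
    (hnoeth : noetherian R) (hloc : local_ring m)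
    (C : lmodType R -> Prop) (hC : resolving C)
    (X : lmodType R) (hX : C X) (hXnf : ~ free_module X) :
  exists X' : lmodType R,
    [/\ C X', ~ free_module X',
        (step X X' <= 2%:E * dim_locus (NF X))%E
      & free_on_punctured_spectrum m X'].
Proof.
have [pm pmE] := local_prime hnoeth hloc.
(* [m] lies in [NF X], so the dimension is neither [-oo] nor negative, and the natural number taken
   for [d] below is the dimension itself. *)
have dim_ge0 : ((0%:Z)%:E <= dim_locus (NF X))%E.
  exact: dim_locus_ge (NF_max hnoeth hloc hC pmE hXnf hX) (chain_above0 pm).
have chain_dim := @dim_locus_ge _ (NF X).
case: (dim_locus (NF X)) dim_ge0 chain_dim => [d d0 chain_d|_ _|//]; last first.
  have [X' [CX' X'nf X'm]] := free_on_punctured_spectrum_exists hnoeth hloc hC hX hXnf.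
  exists X'; split=> //; rewrite mulry gtr0_sg // mul1e; exact: leey.
have [p n Xp pn|X' [CX' X'nf X'd X'm]] := free_on_punctured_spectrum_res
    (d := `|d|%N) hnoeth hloc hC hX (res_self X) hXnf.
  by have := chain_d _ _ Xp pn; rewrite -lez_nat gez0_abs // -lee_fin.
exists X'; split=> //; apply: (le_trans (step_le X'd)).
rewrite -EFinM lee_fin add0n -muln2 PoszM gez0_abs // mulrC; exact: lexx.
Qed.
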